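(* Let $\Gamma$ be a graph (loops allowed) with $d_i^{\mathrm{in}}\neq 0$ for all vertices $i$, and let $\Gamma[l]$ be its neighborhood graph of order $l\geq 2$. Let $\lambda_i$ and $\lambda_i[l]$ denote the eigenvalues of the normalized Laplace operators of $\Gamma$ and $\Gamma[l]$, respectively. (i) If $1\leq \mathcal{A}[l]\leq \min_{i\neq 0}|\lambda_i[l]|$, then $(\mathcal{A}[l]-1)^{\frac1l}\leq |1-\lambda_i|$ for all $i\neq 0$, where $\mathcal{A}[l]$ is any lower bound for $\min_{i\neq 0}|\lambda_i[l]|$. (ii) If $\min_{i\neq 0}|\lambda_i[l]|\leq \mathcal{B}[l]\leq 1$, then $(1-\mathcal{B}[l])^{\frac1l}\leq \max_i|1-\lambda_i|$, where $\mathcal{B}[l]$ is any upper bound for $\min_{i\neq 0}|\lambda_i[l]|$. (iii) If $1\leq \mathcal{C}[l]\leq \max_i|\lambda_i[l]|$, then $(\mathcal{C}[l]-1)^{\frac1l}\leq \max_i|1-\lambda_i|$, where $\mathcal{C}[l]$ is any lower bound for $\max_i|\lambda_i[l]|$. (iv) If $\max_i|\lambda_i[l]|\leq \mathcal{D}[l]\leq 1$, then $(1-\mathcal{D}[l])^{\frac1l}\leq |1-\lambda_i|$ for all $i$, where $\mathcal{D}[l]$ is any upper bound for $\max_i|\lambda_i[l]|$.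
   Context: A graph $\Gamma=(V,E,w)$ is a finite weighted directed graph, loops allowed, without multiple edges; $w:V\times V\to\mathbb{R}$ is the weight function, $w_{ij}$ is the weight of the directed edge from $j$ to $i$, and $w_{ij}=0$ if and only if there is no such edge. Weights may be positive or negative. $d_i^{\mathrm{in}}=\sum_j w_{ij}$. For a graph with all $d_i^{\mathrm{in}}\neq 0$ the normalized Laplace operator on complex valued functions on $V$ is $\Delta v(i)=v(i)-\frac{1}{d_i^{\mathrm{in}}}\sum_j w_{ij}v(j)$. Eigenvalues are counted with algebraic multiplicity and indexed $0,\dots,n-1$ ($n=|V|$), where index $0$ denotes the eigenvalue $\lambda_0=\lambda_0[l]=0$ corresponding to the constant function. If $d_i^{\mathrm{in}}\ne0$ for all $i\in V$, the neighborhood graph $\Gamma[l]$ of order $l\ge 2$ is the graph on the vertex set $V$ with weights $w_{ij}[l]=\sum_{k_1,\ldots,k_{l-1}\in V}\frac{1}{d^{\mathrm{in}}_{k_1}}\cdots\frac{1}{d^{\mathrm{in}}_{k_{l-1}}}w_{ik_1}w_{k_1k_2}\cdots w_{k_{l-1}j}$ for the edge from $j$ to $i$. *)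

(* Defs.v *)
From mathcomp Require Export all_boot all_order all_algebra.
From mathcomp Require Export all_classical all_reals all_analysis.
From mathcomp Require Export complex.

Set Implicit Arguments.
Unset Strict Implicit.
Unset Printing Implicit Defensive.

Import Order.TTheory GRing.Theory Num.Theory.
Local Open Scope ring_scope.
Local Open Scope complex_scope.

(* [edge j i] is the directed edge from j to i, whose weight is [weight i j]. *)
Record graph (R : realType) (V : finType) := Graph {
  edge : rel V;
  weight : V -> V -> R;
  weight_eq0 : forall i j : V, weight i j = 0 <-> ~~ edge j i }.

Section Graph.
Variables (R : realType) (V : finType).
Implicit Types (G : graph R V) (l : nat).

Definition indeg G (i : V) : R := \sum_(j : V) weight G i j.

(* The factor 1 / d_i is junk when d_i = 0. *)
Definition laplace G (v : V -> R[i]) (i : V) : R[i] :=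
  v i - ((indeg G i)^-1)%:C * \sum_(j : V) (weight G i j)%:C * v j.

(* Matrix of [laplace G] in the basis of indicator functions of vertices. *)
Definition laplace_mx G : 'M[R[i]]_#|V| :=
  \matrix_(a, b) laplace G (fun k => (k == enum_val b)%:R) (enum_val a).

(* [lam] enumerates the eigenvalues of [laplace G] with algebraic multiplicity;
   the index of value 0 is reserved for the eigenvalue 0 of the constant
   functions, the order of the other ones is arbitrary. *)
Definition laplace_spectrum G (lam : 'I_#|V| -> R[i]) : Prop :=
  char_poly (laplace_mx G) = \prod_a ('X - (lam a)%:P) /\
  (forall a : 'I_#|V|, val a = 0%N -> lam a = 0).

(* w_{i k_1} w_{k_1 k_2} ... w_{k_m j} for ks = [:: k_1; ...; k_m] *)
Fixpoint walk_weight G (i : V) (ks : seq V) (j : V) : R :=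
  if ks is k :: ks' then weight G i k * walk_weight G k ks' j
  else weight G i j.

Definition nbhd_weight G l (i j : V) : R :=
  \sum_(ks : l.-1.-tuple V)
    (\prod_(k <- ks) (indeg G k)^-1) * walk_weight G i ks j.

Definition nbhd_edge G l : rel V := fun j i => nbhd_weight G l i j != 0.

Lemma nbhd_weight_eq0 G l (i j : V) :
  nbhd_weight G l i j = 0 <-> ~~ nbhd_edge G l j i.
Proof. by rewrite /nbhd_edge negbK; split => /eqP. Qed.

Definition nbhd_graph G l : graph R V := Graph (@nbhd_weight_eq0 G l).

End Graph.

Section Extrema.
Variables (R : realType) (n : nat).
Implicit Types f : 'I_n -> R[i].

(* Extended-real valued because a graph with a single vertex has no index
   other than 0, in which case the minimum is +oo. *)
Definition min_norm_neq0 f : \bar R :=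
  \big[mine/+oo%E]_(a < n | val a != 0%N) (ComplexField.Normc.normc (f a))%:E.

(* Moduli are nonnegative, so the default value 0 never affects the maximum. *)
Definition max_norm f : R := \big[Num.max/0]_(a < n) ComplexField.Normc.normc (f a).

End Extrema.

(* Main.v *)
Require Import Defs.
From mathcomp Require Import ring.
Import Order.TTheory GRing.Theory Num.Theory.
Local Open Scope ring_scope.
Local Open Scope complex_scope.

Set Implicit Arguments.
Unset Strict Implicit.
Unset Printing Implicit Defensive.

(** Write the Laplacian of the graph as [1 - P], where [P] is the transition
matrix, with entries [w_ij / d_i]. Expanding [P ^+ l] as a sum over walks gives
[w_ij[l] = d_i * (P ^+ l)_ij]. The rows of [P], hence of [P ^+ l], sum to 1, so
that the neighborhood graph has the same in-degrees as the graph itself, and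
its transition matrix is [P ^+ l] ([transition_mx_nbhd]).

By the spectral mapping theorem ([char_poly_horner_mx]), the eigenvalues of
[1 - P ^+ l], counted with multiplicity, are the [1 - (1 - lambda) ^ l] for
[lambda] an eigenvalue of [1 - P]. The reserved eigenvalue 0 of the constant
functions corresponds to itself, since [1 - (1 - 0) ^ l = 0], so it cancels
from the two factored characteristic polynomials and the remaining eigenvalues
correspond to each other ([nbhd_spectrum]).

For corresponding eigenvalues the triangle inequality then reads
[1 - |1 - lambda| ^ l <= |lambda[l]| <= 1 + |1 - lambda| ^ l]. The upper
estimate gives (i) and (iii), the lower one gives (ii) and (iv), after
extracting an l-th root. *)

(** * Characteristic polynomial of a polynomial in a matrix *)

Lemma char_poly_conj (F : fieldType) (n : nat) (U A : 'M[F]_n) :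
  U \in unitmx -> char_poly (U *m A *m invmx U) = char_poly A.
Proof.
move=> Uu; rewrite /char_poly /char_poly_mx.
have UV : map_mx polyC U *m map_mx polyC (invmx U) = 1%:M.
  by rewrite -map_mxM mulmxV// map_mx1.
have -> : 'X%:M - map_mx polyC (U *m A *m invmx U) =
    map_mx polyC U *m ('X%:M - map_mx polyC A) *m map_mx polyC (invmx U).
  rewrite !map_mxM mulmxBr mulmxBl; congr (_ - _).
  by rewrite scalar_mxC -mulmxA UV mulmx1.
by rewrite !det_mulmx mulrAC -det_mulmx UV det1 mul1r.
Qed.

Lemma mulmx_trig (R : pzRingType) (n : nat) (A B : 'M[R]_n) :
  is_trig_mx A -> is_trig_mx B ->
  is_trig_mx (A *m B) /\ forall i, (A *m B) i i = A i i * B i i.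
Proof.
move=> /is_trig_mxP tA /is_trig_mxP tB; split.
  apply/is_trig_mxP => i j lij; rewrite mxE big1// => k _.
  have [lik|lki] := ltnP i k; first by rewrite tA// mul0r.
  by rewrite tB ?mulr0// (leq_ltn_trans lki).
move=> i; rewrite mxE (bigD1 i)//= big1 ?addr0// => k.
rewrite -val_eqE /= neq_ltn => /orP[lki|lik]; last by rewrite tA// mul0r.
by rewrite tB// mulr0.
Qed.

Lemma horner_mx_trig (R : comNzRingType) (n : nat) (T : 'M[R]_n.+1)
    (q : {poly R}) :
  is_trig_mx T ->
  is_trig_mx (horner_mx T q) /\ forall i, horner_mx T q i i = q.[T i i].
Proof.
move=> tT; elim/poly_ind: q => [|q c [tq dq]].
  by rewrite rmorph0; split=> [|i]; rewrite ?mx0_is_trig// horner0 mxE.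
have [tqT dqT] := mulmx_trig tq tT.
rewrite rmorphD rmorphM /= horner_mx_X horner_mx_C; split.
  apply/is_trig_mxP => i j lij; rewrite mxE (is_trig_mxP tqT)// add0r.
  by rewrite mxE -val_eqE /= ltn_eqF.
by move=> i; rewrite mxE dqT dq mxE eqxx hornerMXaddC.
Qed.

(** By Schur's theorem [A] is similar to a triangular matrix, on whose
diagonal a polynomial acts entrywise. That diagonal lists the [lam a], possibly
in another order, because a product of linear factors determines its roots up
to permutation. *)
Lemma char_poly_horner_mx (C : numClosedFieldType) (n : nat) (A : 'M[C]_n.+1)
    (lam : 'I_n.+1 -> C) (q : {poly C}) :
  char_poly A = \prod_a ('X - (lam a)%:P) ->
  char_poly (horner_mx A q) = \prod_a ('X - (q.[lam a])%:P).
Proof.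
move=> Alam; have [P Pu] := Schur A (ltn0Sn n).
have {}Pu : P \in unitmx by apply: unitarymx_unit.
rewrite /mxred.similar_to /= -[X in is_trig_mx X]/(mxred.conjmx P A).
rewrite mxred.conjumx//; set T := P *m A *m _ => tT.
have [tq dq] := horner_mx_trig q tT.
rewrite -(@char_poly_conj _ _ P)// -horner_mx_uconj// -/T char_poly_trig//.
rewrite (eq_bigr (fun i => 'X - (q.[T i i])%:P)); last first.
  by move=> i _; congr (_ - _%:P); apply: dq.
have : \prod_i ('X - (T i i)%:P) = \prod_a ('X - (lam a)%:P).
  by rewrite -Alam -(@char_poly_conj _ _ P)// char_poly_trig.
have E (f : 'I_n.+1 -> C) : \prod_i ('X - (f i)%:P) =
    \prod_(x <- [seq f i | i <- enum 'I_n.+1]) ('X - x%:P).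
  by rewrite big_map big_enum.
rewrite E [RHS]E => /prod_XsubC_eq Tlam.
rewrite (E (fun i => q.[T i i])) (E (fun i => q.[lam i])).
rewrite (map_comp (horner q) (fun i => T i i)) (map_comp (horner q) lam).
by apply: perm_big; apply: perm_map.
Qed.

(** Spectral mapping for [1 - (1 - 'X) ^+ l]: this is how the Laplacian of
the neighborhood graph depends on that of the graph. *)
Lemma char_poly_sub1_exp (C : numClosedFieldType) (n : nat) (A : 'M[C]_n)
    (mu : 'I_n -> C) (l : nat) :
  char_poly (1%:M - A) = \prod_a ('X - (mu a)%:P) ->
  char_poly (1%:M - A ^+ l) = \prod_a ('X - (1 - (1 - mu a) ^+ l)%:P).
Proof.
case: n A mu => [|n] A mu Amu.
  by rewrite big_ord0 /char_poly det_mx00.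
have := char_poly_horner_mx (1 - (1 - 'X) ^+ l) Amu.
rewrite rmorphB rmorphXn rmorphB /= rmorph1 horner_mx_X.
rewrite (_ : 1 - (1%:M - A) = A); last by rewrite opprB addrC subrK.
by under eq_bigr do rewrite !hornerE.
Qed.

(** * Transition matrix of the neighborhood graph *)

Definition transition_mx (R : realType) (V : finType) (G : graph R V) :
    'M[R]_#|V| :=
  \matrix_(a, b)
    ((indeg G (enum_val a))^-1 * weight G (enum_val a) (enum_val b)).

Lemma laplace_mxE (R : realType) (V : finType) (G : graph R V) :
  laplace_mx G = 1%:M - map_mx (real_complex R) (transition_mx G).
Proof.
apply/matrixP => a b; rewrite !mxE /laplace (inj_eq enum_val_inj).
congr (_ - _); rewrite rmorphM; congr (_ * _).
rewrite (bigD1 (enum_val b))//= eqxx mulr1 big1 ?addr0// => k /negPf->.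
by rewrite mulr0.
Qed.

Lemma big_tuple_cons (R : nmodType) (T : finType) (m : nat)
    (F : m.+1.-tuple T -> R) :
  \sum_ks F ks = \sum_k \sum_(ks : m.-tuple T) F (cons_tuple k ks).
Proof.
rewrite pair_big /= (reindex (fun p : T * m.-tuple T => cons_tuple p.1 p.2))//=.
exists (fun ks : m.+1.-tuple T => (thead ks, [tuple of behead ks]))
  => [[k ks]|ks] _.
  by congr (_, _); apply: val_inj.
by rewrite [RHS]tuple_eta; apply: val_inj.
Qed.

(** Expansion of a matrix power as a sum over walks. There is one more factor
[1 / d] than intermediate vertices: the one of the starting vertex [i], which
stands in front of the sum. *)
Lemma expr_transition_mx (R : realType) (V : finType) (G : graph R V) (m : nat)
    (i j : V) :
  (transition_mx G ^+ m.+1) (enum_rank i) (enum_rank j) =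
  (indeg G i)^-1 * \sum_(ks : m.-tuple V)
    (\prod_(k <- ks) (indeg G k)^-1) * walk_weight G i ks j.
Proof.
elim: m i => [|m IHm] i.
  rewrite expr1 mxE !enum_rankK (big_pred1 [tuple]) ?big_nil ?mul1r// => ks.
  by rewrite (tuple0 ks) /= eqxx.
rewrite exprS mxE (reindex_onto enum_rank enum_val) => [|a _];
  last exact: enum_valK.
rewrite (eq_bigl xpredT) => [|k]; last by rewrite enum_rankK eqxx.
rewrite big_tuple_cons mulr_sumr; apply: eq_bigr => k _.
rewrite IHm mxE !enum_rankK -mulrA; congr (_ * _); rewrite !mulr_sumr.
apply: eq_bigr => ks _; rewrite /= big_cons; ring.
Qed.

Lemma nbhd_weightE (R : realType) (V : finType) (G : graph R V) (l : nat)
    (i j : V) :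
  (0 < l)%N -> indeg G i != 0 ->
  nbhd_weight G l i j =
  indeg G i * (transition_mx G ^+ l) (enum_rank i) (enum_rank j).
Proof. by case: l => // m _ di; rewrite expr_transition_mx mulVKf. Qed.

(** The matrix [transition_mx G] fixes the all-ones vector, and so do its
powers. *)
Lemma expr_transition_mx_row_sum (R : realType) (V : finType) (G : graph R V)
    (l : nat) (a : 'I_#|V|) :
  (forall i, indeg G i != 0) -> \sum_b (transition_mx G ^+ l) a b = 1.
Proof.
move=> dG; elim: l a => [|l IHl] a.
  rewrite expr0 (bigD1 a)//= mxE eqxx big1 ?addr0// => b ba.
  by rewrite mxE eq_sym (negPf ba).
under eq_bigr do rewrite exprS mxE.
rewrite exchange_big /=; under eq_bigr do rewrite -mulr_sumr IHl mulr1 mxE.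
rewrite -mulr_sumr -(mulVf (dG (enum_val a))); congr (_ * _).
rewrite [RHS](reindex_onto enum_val enum_rank) /= => [|k _];
  last exact: enum_rankK.
by apply: eq_bigl => b; rewrite enum_valK eqxx.
Qed.

Lemma indeg_nbhd_graph (R : realType) (V : finType) (G : graph R V) (l : nat)
    (i : V) :
  (0 < l)%N -> (forall k, indeg G k != 0) ->
  indeg (nbhd_graph G l) i = indeg G i.
Proof.
move=> l0 dG; rewrite /indeg /=.
under eq_bigr do rewrite nbhd_weightE//.
rewrite -mulr_sumr -[RHS]mulr1; congr (_ * _).
rewrite -(expr_transition_mx_row_sum l (enum_rank i) dG).
rewrite [RHS](reindex_onto enum_rank enum_val) /= => [|a _];
  last exact: enum_valK.
by apply: eq_bigl => k; rewrite enum_rankK eqxx.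
Qed.

Lemma transition_mx_nbhd (R : realType) (V : finType) (G : graph R V)
    (l : nat) :
  (0 < l)%N -> (forall i, indeg G i != 0) ->
  transition_mx (nbhd_graph G l) = transition_mx G ^+ l.
Proof.
move=> l0 dG; apply/matrixP => a b.
by rewrite mxE indeg_nbhd_graph//= nbhd_weightE// mulKf// !enum_valK.
Qed.

(** * Matching the two spectra *)

(** Once the common factors, those of the indices outside [P], are cancelled,
each remaining root of one side is a root of the other. *)
Lemma prod_XsubC_match (F : idomainType) (I : finType) (P : pred I)
    (f g : I -> F) :
  \prod_a ('X - (f a)%:P) = \prod_a ('X - (g a)%:P) ->
  (forall a, ~~ P a -> f a = g a) ->
  forall a, P a -> exists2 b, P b & f a = g b.
Proof.
move=> fg eq_fg a Pa; rewrite (bigID P) [RHS](bigID P) /= in fg.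
move: fg.
rewrite -(eq_bigr _ (fun b nPb => congr1 (fun x => 'X - x%:P) (eq_fg b nPb))).
move/mulIf => /(_ (monic_neq0 (monic_prod_XsubC _ _ _))).
move/(congr1 (horner^~ (f a))).
rewrite !horner_prod (bigD1 a)//= !hornerE subrr.
rewrite mul0r => /esym/eqP; rewrite prodf_seq_eq0 => /hasP[b _ /andP[Pb]].
by rewrite !hornerE subr_eq0 => /eqP; exists b.
Qed.

Lemma map_mx_exp (R S : pzRingType) (f : {rmorphism R -> S}) (n : nat)
    (A : 'M[R]_n) (l : nat) :
  map_mx f (A ^+ l) = map_mx f A ^+ l.
Proof. by elim: l => [|l IHl]; rewrite ?map_mx1// !exprS map_mxM IHl. Qed.

(** Both directions are needed: (i) and (iv) bound every eigenvalue of the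
graph, whereas (ii) and (iii) need bounds on every eigenvalue of the
neighborhood graph. Agreement on index 0 lets the index range in the minimum of
(i) be respected. *)
Lemma nbhd_spectrum (R : realType) (V : finType) (G : graph R V) (l : nat)
    (lam laml : 'I_#|V| -> R[i]) :
  (forall i, indeg G i != 0) -> (0 < l)%N ->
  laplace_spectrum G lam -> laplace_spectrum (nbhd_graph G l) laml ->
  (forall a, exists2 b, (val a == 0%N) = (val b == 0%N) &
    laml b = 1 - (1 - lam a) ^+ l) /\
  (forall b, exists2 a, (val a == 0%N) = (val b == 0%N) &
    laml b = 1 - (1 - lam a) ^+ l).
Proof.
move=> dG l0 [chG lam0] [chGl laml0].
have := chG; rewrite laplace_mxE => /(char_poly_sub1_exp l).
rewrite -map_mx_exp -transition_mx_nbhd// -laplace_mxE chGl => E.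
have E0 a : ~~ (val a != 0%N) -> laml a = 1 - (1 - lam a) ^+ l.
  (* both reserved eigenvalues are 0, and 1 - (1 - 0) ^+ l = 0 *)
  by move=> /negPn/eqP a0; rewrite lam0// laml0// subr0 expr1n subrr.
have M1 := prod_XsubC_match E E0.
have M2 := prod_XsubC_match (esym E) (fun a n => esym (E0 a n)).
split=> a; have [a0|an0] := boolP (val a == 0%N).
- by exists a; rewrite ?a0// E0 ?negbK.
- by have [b bn0 ->] := M2 a an0; exists b => //; rewrite (negPf bn0).
- by exists a; rewrite ?a0// E0 ?negbK.
- by have [b bn0 ->] := M1 a an0; exists b => //; rewrite (negPf bn0).
Qed.

(** * Estimates on moduli *)

Local Notation normc := ComplexField.Normc.normc.

Lemma normcX (R : rcfType) (z : R[i]) (l : nat) : normc (z ^+ l) = normc z ^+ l.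
Proof.
elim: l => [|l IHl]; first by rewrite !expr0 ComplexField.Normc.normc1.
by rewrite !exprS ComplexField.Normc.normcM IHl.
Qed.

Lemma normc_sub1_exp_le (R : rcfType) (z : R[i]) (l : nat) :
  normc (1 - z ^+ l) <= 1 + normc z ^+ l.
Proof.
rewrite -normcX -(normcN (z ^+ l)).
rewrite -[X in _ <= X + _](ComplexField.Normc.normc1 R).
exact: le_normcD.
Qed.

Lemma normc_sub1_exp_ge (R : rcfType) (z : R[i]) (l : nat) :
  1 - normc z ^+ l <= normc (1 - z ^+ l).
Proof.
rewrite lerBlDr -normcX -[X in X <= _](ComplexField.Normc.normc1 R).
by rewrite -[X in normc X <= _](subrK (z ^+ l)) le_normcD.
Qed.

Lemma powR_inv_le (R : realType) (x y : R) (l : nat) :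
  (0 < l)%N -> 0 <= x -> 0 <= y -> x <= y ^+ l -> x `^ l%:R^-1 <= y.
Proof.
move=> l0 x0 y0 xy; have ln0 : l%:R != 0 :> R by rewrite pnatr_eq0 -lt0n.
have -> : y = (y ^+ l) `^ l%:R^-1.
  by rewrite -powR_mulrn// -powRrM mulfV// powRr1.
by rewrite ge0_ler_powR ?nnegrE ?invr_ge0 ?exprn_ge0.
Qed.

Lemma normc_ge0 (R : rcfType) (z : R[i]) : 0 <= normc z.
Proof. by case: z => a b; rewrite /normc sqrtr_ge0. Qed.

Theorem theorem9p2 (R : realType) (V : finType) (G : graph R V) (l : nat)
    (lam laml : 'I_#|V| -> R[i]) :
  (forall i : V, indeg G i != 0) ->
  (2 <= l)%N ->
  laplace_spectrum G lam ->
  laplace_spectrum (nbhd_graph G l) laml ->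
  [/\ forall A : R, 1 <= A -> (A%:E <= min_norm_neq0 laml)%E ->
        forall i : 'I_#|V|, val i != 0%N ->
          (A - 1) `^ l%:R^-1 <= ComplexField.Normc.normc (1 - lam i),
      forall B : R, (min_norm_neq0 laml <= B%:E)%E -> B <= 1 ->
        (1 - B) `^ l%:R^-1 <= max_norm (fun i => 1 - lam i),
      forall C : R, 1 <= C -> C <= max_norm laml ->
        (C - 1) `^ l%:R^-1 <= max_norm (fun i => 1 - lam i) &
      forall D : R, max_norm laml <= D -> D <= 1 ->
        forall i : 'I_#|V|,
          (1 - D) `^ l%:R^-1 <= ComplexField.Normc.normc (1 - lam i)].
Proof.
move=> dG l2 sG sGl; have l0 : (0 < l)%N by apply: leq_trans l2.
have [lam_laml laml_lam] := nbhd_spectrum dG l0 sG sGl.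
set M := max_norm (fun i => 1 - lam i).
have M0 : 0 <= M by apply: bigmax_ge_id.
have leM a : normc (1 - lam a) ^+ l <= M ^+ l.
  rewrite lerXn2r ?nnegrE ?normc_ge0//.
  exact: (le_bigmax _ (fun i => normc (1 - lam i))).
split.
- move=> A A1 Amin a an0; have [b ab lb] := lam_laml a.
  apply: powR_inv_le; rewrite ?subr_ge0 ?normc_ge0// lerBlDl.
  apply: le_trans (normc_sub1_exp_le _ _); rewrite -lb -lee_fin.
  by apply: (le_trans Amin); apply: bigmin_inf (lexx _); rewrite -ab.
- move=> B minB B1; apply: powR_inv_le; rewrite ?subr_ge0//.
  rewrite lerBlDr -lerBlDl -lee_fin; apply: le_trans minB.
  (* the minimum is +oo when no index is nonzero *)
  apply: le_bigmin => [|b _]; first exact: leey.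
  have [a _ ->] := laml_lam b; rewrite lee_fin.
  by apply: le_trans (normc_sub1_exp_ge _ _); rewrite lerB.
- move=> C C1 Cmax; apply: powR_inv_le; rewrite ?subr_ge0// lerBlDl.
  apply: (le_trans Cmax); apply: bigmax_le => [|b _].
    by rewrite addr_ge0 ?exprn_ge0.
  have [a _ ->] := laml_lam b.
  by apply: (le_trans (normc_sub1_exp_le _ _)); rewrite lerD2l.
- move=> D maxD D1 a; have [b _ lb] := lam_laml a.
  apply: powR_inv_le; rewrite ?subr_ge0 ?normc_ge0//.
  rewrite lerBlDr -lerBlDl; apply: le_trans maxD.
  apply: (le_trans (normc_sub1_exp_ge _ _)); rewrite -lb.
  exact: (le_bigmax _ (fun b => normc (laml b))).
Qed.
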